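(* Let $\mathbb{K}$ be an infinite field and let $R=\mathbb{K}[[(\phi_1(t),\psi_1(u)),\ldots,(\phi_n(t),\psi_n(u))]]\subseteq\mathbb{K}[[t]]\times\mathbb{K}[[u]]$ be a two-branch algebroid curve such that (i) the multiplicity sequences $M_1$ and $M_2$ of the two branches $R^1=\mathbb{K}[[\phi_1(t),\ldots,\phi_n(t)]]$ and $R^2=\mathbb{K}[[\psi_1(u),\ldots,\psi_n(u)]]$ are equal; (ii) the set $Dis(1,2)=\{i\in\{1,\ldots,n\}:\mathrm{ord}(\phi_i(t))\ne\mathrm{ord}(\psi_i(u))\}$ is nonempty. Let $D=\min\{\min\{\mathrm{ord}(\phi_i(t)),\mathrm{ord}(\psi_i(u))\}: i\in Dis(1,2)\}$, let $c_r=\sum_{j=1}^{l}M_1[j]$ be the common conductor of the branches, where $l$ is the common length of $M_1=M_2$, and let $c=(c[1],c[2])$ be the conductor of the value semigroup $\nu(R^* )$ of the Arf closure $R^*$ of $R$. Then $$\max\{c_r,D\}\ge c[1]=c[2].$$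
   Context: For $f=(\phi(t),\psi(u))\in\mathbb{K}[[t]]\times\mathbb{K}[[u]]$ put $\nu(f)=(\mathrm{ord}\,\phi,\mathrm{ord}\,\psi)$, with $\mathrm{ord}\,0=\infty$; vectors are compared componentwise. $\mathbb{K}[[f_1,\ldots,f_n]]$ denotes the set of all power series in $f_1,\ldots,f_n$ (elements of positive order in each component), including the constants $\mathbb{K}(1,1)$; similarly in one variable. (When generators have nonzero constant terms it means the closure of the generated $\mathbb{K}$-subalgebra.) Two-branch algebroid curve (given by a parametrization): a ring $R=\mathbb{K}[[(\phi_1,\psi_1),\ldots,(\phi_n,\psi_n)]]$ with all $\phi_i,\psi_i$ of positive order, whose integral closure in its total ring of fractions is $\mathbb{K}[[t]]\times\mathbb{K}[[u]]$. Multiplicity sequence of a branch: for a branch $A=A_1=\mathbb{K}[[\phi_1,\ldots,\phi_n]]\subseteq\mathbb{K}[[t]]$ with integral closure $\mathbb{K}[[t]]$, let $A_{j+1}$ be the blow-up of $A_j$ at its maximal ideal (if $A_j=\mathbb{K}[[y_1,\ldots,y_k]]$ with all $y_i$ of positive order and $x\in A_j$ is an element of minimal positive order, then $A_{j+1}=\mathbb{K}[[x,y_1/x,\ldots,y_k/x]]$), and let $M[j]$ be the minimal positive order of an element of $A_j$. The sequence $M=(M[j])_{j\ge1}$ is nonincreasing and eventually $1$; its length is $l=\max\{j:M[j]\ne1\}$, with $l=1$ if $M=(1,1,\ldots)$. Arf closure: a ring $A\subseteq\mathbb{K}[[t]]\times\mathbb{K}[[u]]$ is Arf if for every $x\in A$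 with $\nu(x)=\alpha$ having finite components, $x^{-1}A(\alpha)$ is a ring, where $A(\alpha)=\{r\in A:\nu(r)\ge\alpha\}$. $R^*$ is the smallest Arf ring containing $R$; $\nu(R^* )$ is the set of values in $\mathbb{N}^2$ of elements of $R^*$, and its conductor is the smallest $c\in\mathbb{N}^2$ with $c+\mathbb{N}^2\subseteq\nu(R^* )$. *)

(* Defs.v *)
From HB Require Import structures.
From mathcomp Require Import all_boot all_order all_algebra.
From mathcomp Require Import boolp classical_sets cardinality.

Set Implicit Arguments.
Unset Strict Implicit.
Unset Printing Implicit Defensive.

Import GRing.Theory.

Local Open Scope classical_set_scope.
Local Open Scope ring_scope.

Record fps (K : Type) := Fps { coef :> nat -> K }.

Lemma fpsP (K : Type) (f g : fps K) : (forall k, f k = g k) <-> f = g.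
Proof.
split=> [|->//]; case: f g => [f] [g] /= fg.
by congr Fps; apply/funext.
Qed.

HB.instance Definition _ (K : Type) := gen_eqMixin (fps K).
HB.instance Definition _ (K : Type) := gen_choiceMixin (fps K).

Section FpsAlgebra.
Variable K : fieldType.
Implicit Types f g h : fps K.

Definition fps_add f g := Fps (fun k => f k + g k).
Definition fps_opp f := Fps (fun k => - f k).
Definition fps_zero : fps K := Fps (fun=> 0).
Definition fps_one : fps K := Fps (fun k => (k == 0)%:R).
Definition fps_mul f g := Fps (fun k => \sum_(i < k.+1) f i * g (k - i)%N).
Definition fps_scale (a : K) f := Fps (fun k => a * f k).

Fact fps_addA : associative fps_add.
Proof. by move=> f g h; apply/fpsP => k /=; rewrite addrA. Qed.
Fact fps_addC : commutative fps_add.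
Proof. by move=> f g; apply/fpsP => k /=; rewrite addrC. Qed.
Fact fps_add0 : left_id fps_zero fps_add.
Proof. by move=> f; apply/fpsP => k /=; rewrite add0r. Qed.
Fact fps_addN : left_inverse fps_zero fps_opp fps_add.
Proof. by move=> f; apply/fpsP => k /=; rewrite addNr. Qed.

HB.instance Definition _ :=
  GRing.isZmodule.Build (fps K) fps_addA fps_addC fps_add0 fps_addN.

Let trunc N f : {poly K} := \poly_(i < N) f i.

Let coef_mul_trunc N f g k :
  (k < N)%N -> fps_mul f g k = (trunc N f * trunc N g)`_k.
Proof.
move=> kN; rewrite coefM /=; apply: eq_bigr => i _.
rewrite /trunc !coef_poly (leq_ltn_trans _ kN) ?(leq_ltn_trans (leq_subr _ _) kN) //.
by rewrite -ltnS.
Qed.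

Fact fps_mulC : commutative fps_mul.
Proof.
by move=> f g; apply/fpsP => k; rewrite !(@coef_mul_trunc k.+1)// mulrC.
Qed.

Fact fps_mulA : associative fps_mul.
Proof.
move=> f g h; apply/fpsP => k.
transitivity ((trunc k.+1 f * (trunc k.+1 g * trunc k.+1 h))`_k).
  rewrite coefM /=; apply: eq_bigr => i _; rewrite {1}/trunc coef_poly ltn_ord.
  by rewrite -coef_mul_trunc // ltnS leq_subr.
rewrite mulrA coefM /=; apply: eq_bigr => i _.
rewrite [trunc _ h]/trunc coef_poly ltnS leq_subr.
by rewrite -coef_mul_trunc.
Qed.

Fact fps_mul1 : left_id fps_one fps_mul.
Proof.
move=> f; apply/fpsP => k /=; rewrite big_ord_recl /= mul1r subn0.
by rewrite big1 ?addr0// => i _; rewrite mul0r.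
Qed.

Fact fps_mulDl : left_distributive fps_mul +%R.
Proof.
move=> f g h; apply/fpsP => k /=; rewrite -big_split /=.
by apply: eq_bigr => i _; rewrite mulrDl.
Qed.

Fact fps_one_neq0 : fps_one != 0.
Proof.
by apply/eqP => /fpsP/(_ 0); apply/eqP; rewrite /= oner_eq0.
Qed.

HB.instance Definition _ := GRing.Zmodule_isComNzRing.Build (fps K)
  fps_mulA fps_mulC fps_mul1 fps_mulDl fps_one_neq0.

Fact fps_scaleA a b f : fps_scale a (fps_scale b f) = fps_scale (a * b) f.
Proof. by apply/fpsP => k /=; rewrite mulrA. Qed.
Fact fps_scale1 : left_id 1 fps_scale.
Proof. by move=> f; apply/fpsP => k /=; rewrite mul1r. Qed.
Fact fps_scaleDr : right_distributive fps_scale +%R.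
Proof. by move=> a f g; apply/fpsP => k /=; rewrite mulrDr. Qed.
Fact fps_scaleDl f : {morph fps_scale^~ f : a b / a + b}.
Proof. by move=> a b; apply/fpsP => k /=; rewrite mulrDl. Qed.

HB.instance Definition _ := GRing.Zmodule_isLmodule.Build K (fps K)
  fps_scaleA fps_scale1 fps_scaleDr fps_scaleDl.

Fact fps_scaleAl (a : K) f g : a *: (f * g) = (a *: f) * g.
Proof.
apply/fpsP => k /=; rewrite mulr_sumr.
by apply: eq_bigr => i _; rewrite mulrA.
Qed.

HB.instance Definition _ :=
  GRing.Lmodule_isLalgebra.Build K (fps K) fps_scaleAl.
HB.instance Definition _ := GRing.Lalgebra_isComAlgebra.Build K (fps K).

Fixpoint fps_invs f n : seq K :=
  if n is m.+1 then
    let s := fps_invs f m in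
    rcons s ((f 0)^-1 * ((m == 0)%:R - \sum_(i < m) s`_i * f (m - i)%N))
  else [::].

Definition fps_unit : {pred fps K} := fun f => f 0 != 0.
Definition fps_inv f : fps K :=
  if fps_unit f then Fps (fun k => (fps_invs f k.+1)`_k) else f.

Let size_invs f n : size (fps_invs f n) = n.
Proof. by elim: n => //= n IHn; rewrite size_rcons IHn. Qed.

Let nth_invs f n k : (k < n)%N -> (fps_invs f n)`_k = (fps_invs f k.+1)`_k.
Proof.
elim: n => // n IHn; rewrite ltnS leq_eqVlt => /orP[/eqP->//|kn].
by rewrite [in LHS]/= nth_rcons size_invs kn IHn.
Qed.

Fact fps_mulVf : {in fps_unit, left_inverse 1 fps_inv *%R}.
Proof.
move=> f uf; have f0 : f 0 != 0 by exact: uf.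
apply/fpsP => k; rewrite /fps_inv /fps_unit f0.
rewrite [LHS]/= big_ord_recr /= subnn.
rewrite nth_rcons size_invs ltnn eqxx.
rewrite [in X in _ + X]mulrC mulVKf // addrC.
under [X in _ + X]eq_bigr => i _ do
  rewrite -[rcons _ _]/(fps_invs f i.+1) -(nth_invs f (ltn_ord i)).
by rewrite subrK.
Qed.

Fact fps_unitPl f g : g * f = 1 -> fps_unit f.
Proof.
move=> /fpsP/(_ 0); rewrite /= big_ord1 /= subnn => gf1.
by apply/eqP => f0; move: gf1; rewrite f0 mulr0; apply/eqP;
   rewrite eq_sym oner_eq0.
Qed.

Fact fps_inv_out : {in [predC fps_unit], fps_inv =1 id}.
Proof. by move=> f; rewrite inE /fps_inv /in_mem /= => /negbTE ->. Qed.

HB.instance Definition _ := GRing.ComNzRing_hasMulInverse.Build (fps K)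
  fps_mulVf fps_unitPl fps_inv_out.

Let first_coef f : f != 0 ->
  exists2 n, f n != 0 & forall i, (i < n)%N -> f i = 0.
Proof.
move=> f0; have exf : exists n, f n != 0.
  apply: contrapT => nex; move/eqP: f0; apply; apply/fpsP => k.
  by apply/eqP/negPn/negP => fk; apply: nex; exists k.
exists (ex_minn exf); case: ex_minnP => // m _ mmin i im.
by apply/eqP/negPn/negP => /mmin; rewrite leqNgt im.
Qed.

Fact fps_mulf_eq0 f g : f * g = 0 -> (f == 0) || (g == 0).
Proof.
move=> fg0; apply/negPn/negP; rewrite negb_or => /andP[].
move=> /first_coef[a fa amin] /first_coef[b gb bmin].
move/fpsP: fg0 => /(_ (a + b)%N) /=.
have aab : (a < (a + b).+1)%N by rewrite ltnS leq_addr.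
rewrite (bigD1 (Ordinal aab)) //= big1 => [|i ia].
  by rewrite addr0 addKn; apply/eqP; rewrite mulf_neq0.
case: (ltngtP i a) => [/amin->|ai|ia']; first by rewrite mul0r.
  rewrite (bmin (a + b - i)%N) ?mulr0// ltn_subLR ?ltn_add2r//.
  by rewrite -ltnS.
by case/eqP: ia; apply: val_inj.
Qed.

HB.instance Definition _ :=
  GRing.ComUnitRing_isIntegral.Build (fps K) fps_mulf_eq0.

End FpsAlgebra.

(* Extended natural numbers: [None] is the value infinity. *)
Definition leqo (n : nat) (e : option nat) : bool :=
  if e is Some m then (n <= m)%N else true.

Definition mino (e1 e2 : option nat) : option nat :=
  match e1, e2 with
  | Some m, Some n => Some (minn m n)
  | Some m, None => Some m
  | None, _ => e2
  end.

Definition least (S : set nat) (m : nat) : Prop :=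
  S m /\ forall k, S k -> (m <= k)%N.

Section Orders.
Variable K : fieldType.

Definition ord (f : fps K) : option nat :=
  if pselect (exists k, f k != 0) is left ex then Some (ex_minn ex) else None.

Definition nu (f : fps K * fps K) : option nat * option nat :=
  (ord f.1, ord f.2).

Definition nu_ge (a : nat * nat) (f : fps K * fps K) : Prop :=
  leqo a.1 (nu f).1 /\ leqo a.2 (nu f).2.

Definition ord_filtration (N : nat) : set (fps K) := [set f | leqo N (ord f)].

Definition nu_filtration (N : nat) : set (fps K * fps K) := nu_ge (N, N).

End Orders.

Section GeneratedRings.
Variables (K : fieldType) (B : algType K).
(* [J N] is the ideal of the elements all of whose components have
   order at least [N]; convergence is with respect to this filtration. *)
Variable J : nat -> set B.

(* For [f i] of positive order, [series_ring f] is K[[f_1, ..., f_n]]: the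
   sums of all series  sum_m c_m f^m.  Monomials having an exponent at
   least [N] lie in [J N], so only the exponents below [N] are kept there. *)
Definition series_ring (n : nat) (f : 'I_n -> B) : set B :=
  [set g | exists c : {ffun 'I_n -> nat} -> K, forall N,
     J N (g - \sum_(m : {ffun 'I_n -> 'I_N})
                c [ffun i => val (m i)] *: \prod_(i < n) f i ^+ m i)].

Definition generated_subalgebra (G : set B) : set B :=
  smallest (fun S : set B => GRing.subalg_closed [in S]) G.

Definition adic_closure (S : set B) : set B :=
  [set g | forall N, exists2 s, S s & J N (g - s)].

End GeneratedRings.

Section Branches.
Variable K : fieldType.
Implicit Type A : set (fps K).

Definition branch_ring (n : nat) (y : 'I_n -> fps K) : set (fps K) :=
  series_ring (@ord_filtration K) y.

Definition positive_orders A : set nat :=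
  [set d | (0 < d)%N /\ exists2 r, A r & ord r = Some d].

Definition is_blowup A A' : Prop :=
  exists (k : nat) (y : 'I_k -> fps K) (x : fps K) (d : nat),
    [/\ forall i, leqo 1 (ord (y i)),
        A = branch_ring y,
        A x /\ ord x = Some d,
        least (positive_orders A) d
      & A' = adic_closure (@ord_filtration K) (generated_subalgebra
               ([set x] `|` [set z | exists i, x * z = y i]))].

(* Indices start at 1; the values at index 0 are irrelevant. *)
Definition is_multiplicity_sequence A (M : nat -> nat) : Prop :=
  exists2 T : nat -> set (fps K), T 1 = A &
    forall j, (0 < j)%N ->
      is_blowup (T j) (T j.+1) /\ least (positive_orders (T j)) (M j).

End Branches.

Definition is_length (M : nat -> nat) (l : nat) : Prop :=
  ((forall j, (0 < j)%N -> M j = 1) /\ l = 1) \/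
  [/\ (0 < l)%N, M l <> 1 & forall j, (l < j)%N -> M j = 1].

Section TwoBranches.
Variable K : fieldType.
Local Notation B := (fps K * fps K)%type.
Local Notation Q := ({fraction fps K} * {fraction fps K})%type.
Implicit Types A R : set B.

Definition curve_ring (n : nat) (phi psi : 'I_n -> fps K) : set B :=
  series_ring (@nu_filtration K) (fun i => (phi i, psi i) : B).

Definition to_fractions (f : B) : Q := (FracField.tofrac f.1, FracField.tofrac f.2).

(* The denominators are the elements of [R] with two nonzero components.
   These are regular in [R], and they are all the regular elements of [R]
   as soon as (1, 0) is such a fraction, since then [R] contains some (a, 0)
   and (0, b) with a, b nonzero. *)
Definition total_fractions R : set Q :=
  [set z | exists x y, [/\ R x, R y, y.1 != 0, y.2 != 0
                         & z = to_fractions x / to_fractions y]].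

Definition integral_closure R : set Q :=
  [set z | total_fractions R z /\
    exists p : {poly Q}, [/\ p \is monic, root p z
                           & forall i, (to_fractions @` R) p`_i]].

Definition two_branch_curve (n : nat) (phi psi : 'I_n -> fps K) : Prop :=
  (forall i, leqo 1 (ord (phi i)) /\ leqo 1 (ord (psi i))) /\
  integral_closure (curve_ring phi psi) = range to_fractions.

(* [z] ranges over x^-1 A(a): as nu x = a is finite, x is regular, and r / x
   lies in K[[t]] x K[[u]] for all r with nu r >= a. *)
Definition is_arf A : Prop :=
  GRing.subring_closed [in A] /\
  forall (x : B) (a : nat * nat), A x -> nu x = (Some a.1, Some a.2) ->
    GRing.subring_closed
      [in [set z : B | exists2 r, A r /\ nu_ge a r & x * z = r]].

Definition arf_closure R : set B := smallest is_arf R.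

Definition value_semigroup A : set (nat * nat) :=
  [set a | exists2 r, A r & nu r = (Some a.1, Some a.2)].

End TwoBranches.

Definition conductor_bound (S : set (nat * nat)) (c : nat * nat) : Prop :=
  forall a, (c.1 <= a.1)%N -> (c.2 <= a.2)%N -> S a.

Definition is_conductor (S : set (nat * nat)) (c : nat * nat) : Prop :=
  conductor_bound S c /\
  forall c', conductor_bound S c' -> (c.1 <= c'.1)%N /\ (c.2 <= c'.2)%N.

Definition Dis (K : fieldType) (n : nat) (phi psi : 'I_n -> fps K) :
  set 'I_n := [set i | ord (phi i) <> ord (psi i)].

(* Main.v *)
(* The orders of the first (or second) components of the elements of the Arf
   closure A = R^* are exactly the partial sums s_m = M[1] + ... + M[m].  They
   occur because the closure of a projection of A is a one-branch Arf ring, and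
   dividing a one-branch Arf ring containing the branch by an element of order
   M[1] gives a one-branch Arf ring containing its blow-up.  No others occur
   because A lies in E1 x E2, where each E is built from the branch by
   E_j = K + x_j E_(j+1), with E_(l+1) the whole power series ring.

   Let t <= D be the least order of a component of an element of A whose two
   orders differ.  As both projections have the same orders, A has elements of
   values (t, t), (t, > t) and (> t, t).  Dividing by the first one, the powers
   of the two others separate the components, so the values of A that are at
   least (t, t) are all pairs of partial sums that are at least t, while below
   t all values are diagonal.  Hence c[1] = c[2] <= max (c_r, t). *)
Require Import Defs.
From mathcomp Require Import all_boot all_order all_algebra.
From mathcomp Require Import boolp classical_sets cardinality.

Local Open Scope classical_set_scope.

(** * Subalgebras and power series in given elements *)

Section Subalgebras.
Set Implicit Arguments.
Unset Strict Implicit.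
Unset Printing Implicit Defensive.
Import GRing.Theory.
Local Open Scope ring_scope.
Variables (K : fieldType) (B : comAlgType K).
Implicit Types (S : set B) (J : nat -> set B).

Definition is_subalg S : Prop :=
  [/\ S 1, forall a u v, S u -> S v -> S (a *: u + v)
    & forall u v, S u -> S v -> S (u * v)].

Lemma is_subalgP S : GRing.subalg_closed [in S] <-> is_subalg S.
Proof.
split=> [] [S1 SL SM]; split=> //.
- by move: S1; rewrite inE.
- by move=> a u v Su Sv; move: (SL a u v); rewrite !inE; apply.
- by move=> u v Su Sv; move: (SM u v); rewrite !inE; apply.
- by rewrite inE.
- by move=> a u v; rewrite !inE; apply: SL.
- by move=> u v; rewrite !inE; apply: SM.
Qed.

Section Closure.
Variable S : set B.
Hypothesis Salg : is_subalg S.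

Lemma subalg1 : S 1. Proof. by case: Salg. Qed.

Lemma subalgM u v : S u -> S v -> S (u * v).
Proof. by case: Salg => _ _; apply. Qed.

Lemma subalgD u v : S u -> S v -> S (u + v).
Proof. by case: Salg => _ SL _ Su; rewrite -[u]scale1r; apply: SL. Qed.

Lemma subalg0 : S 0.
Proof.
by case: Salg => S1 SL _; rewrite -(addNr 1) -scaleN1r; apply: SL.
Qed.

Lemma subalgZ a u : S u -> S (a *: u).
Proof.
by case: Salg => _ SL _ Su; rewrite -[_ *: _]addr0; apply/SL/subalg0.
Qed.

Lemma subalgB u v : S u -> S v -> S (u - v).
Proof. by move=> Su Sv; rewrite -scaleN1r; apply/subalgD/subalgZ. Qed.

Lemma subalgX u k : S u -> S (u ^+ k).
Proof.
by move=> Su; elim: k => [|k IH]; rewrite ?exprS; [exact: subalg1|exact: subalgM].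
Qed.

End Closure.

(** [is_arf] speaks of subrings only; once the constants are present, scaling is multiplication by a
    constant. *)
Lemma subring_subalg S : GRing.subring_closed [in S] -> (forall a : K, S a%:A) ->
  is_subalg S.
Proof.
move=> [S1 SB SM] SK.
have SM1 u v : S u -> S v -> S (u * v) by move: (SM u v); rewrite !inE.
have SB1 u v : S u -> S v -> S (u - v) by move: (SB u v); rewrite !inE; apply.
split=> //; first by move: S1; rewrite inE.
move=> a u v Su Sv; rewrite -[v]opprK; apply: (SB1).
  by rewrite -mulr_algl; apply: SM1.
have S0 : S 0 by rewrite -(scale0r 1); exact: SK.
by rewrite -[- v]sub0r; apply: SB1.
Qed.

Lemma subalg_subring S : is_subalg S -> GRing.subring_closed [in S].
Proof.
move=> Salg; split; first by rewrite inE; exact: subalg1.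
- by move=> u v; rewrite !inE; apply: subalgB.
- by move=> u v; rewrite !inE; apply: subalgM.
Qed.

Lemma generated_subalg G : is_subalg (@generated_subalgebra K B G).
Proof.
split=> [T [/is_subalgP Talg _]|a u v Gu Gv T TG|u v Gu Gv T TG].
- exact: subalg1.
- have [/is_subalgP[_ TL _] _] := TG.
  by apply: TL; [exact: Gu|exact: Gv].
- have [/is_subalgP[_ _ TM] _] := TG.
  by apply: TM; [exact: Gu|exact: Gv].
Qed.

Lemma sub_generated G : G `<=` @generated_subalgebra K B G.
Proof. by move=> g Gg T [_]; apply. Qed.

Lemma generated_sub G S : is_subalg S -> G `<=` S ->
  @generated_subalgebra K B G `<=` S.
Proof. by move=> /is_subalgP SA GS g; apply. Qed.

(** The ring obtained in the Arf condition by dividing by [x], in a form free of fractions and of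
    values. *)
Definition colon (x : B) S : set B := [set z | S (x * z)].

Section SeriesRing.
Variables (J : nat -> set B) (n : nat) (f : 'I_n -> B).
Hypotheses (J0 : J 0 = setT) (JN0 : forall N, J N 0) (Jf : forall i, J 1 (f i)).

(** The sum truncated at [N] omits the monomials having an exponent at least [N], so these must be
    negligible modulo [J N]. *)
Lemma series_ring_monomial (m0 : {ffun 'I_n -> nat}) (a : K) :
  (forall N, (exists i, N <= m0 i)%N -> J N (a *: \prod_(i < n) f i ^+ m0 i)) ->
  @series_ring K B J n f (a *: \prod_(i < n) f i ^+ m0 i).
Proof.
move=> Jm; exists (fun m => if m == m0 then a else 0) => N.
have [[i Ni]|big] := pselect (exists i, (N <= m0 i)%N).
  rewrite [X in _ - X]big1 => [|m _]; first by rewrite subr0; apply: Jm; exists i.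
  case: eqP => [/ffunP/(_ i)|_]; last by rewrite scale0r.
  by rewrite ffunE => mi; move: Ni; rewrite -mi leqNgt ltn_ord.
have lt i : (m0 i < N)%N by rewrite ltnNge; apply/negP => ?; apply: big; exists i.
pose m1 := [ffun i => Ordinal (lt i)].
rewrite [X in _ - X](bigD1 m1) //= [X in _ - (_ + X)]big1 ?addr0 => [|m mm1].
  have -> : [ffun i => val (m1 i)] = m0 by apply/ffunP => i; rewrite !ffunE.
  rewrite eqxx.
  have -> : \prod_(i < n) f i ^+ m1 i = \prod_(i < n) f i ^+ m0 i.
    by apply: eq_bigr => i _; rewrite ffunE.
  by rewrite subrr.
case: eqP => [/ffunP e|_]; last exact: scale0r; case/eqP: mm1.
by apply/ffunP => i; apply: val_inj; move: (e i); rewrite !ffunE.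
Qed.

Lemma series_ring_const (a : K) : @series_ring K B J n f a%:A.
Proof.
have -> : a%:A = a *: \prod_(i < n) f i ^+ [ffun _ : 'I_n => 0%N] i :> B.
  by rewrite big1 // => i _; rewrite ffunE.
apply: series_ring_monomial => N [i]; rewrite ffunE leqn0 => /eqP->.
by rewrite J0.
Qed.

Lemma series_ring_gen i : @series_ring K B J n f (f i).
Proof.
have fE : f i = 1 *: \prod_(j < n) f j ^+ [ffun j : 'I_n => (j == i) : nat] j.
  rewrite scale1r (bigD1 i) //= ffunE eqxx expr1.
  have : \prod_(j < n | j != i) f j ^+ [ffun j : 'I_n => (j == i) : nat] j = 1.
    by rewrite big1 // => j ji; rewrite ffunE (negbTE ji).
  by move=> ->; rewrite mulr1.
rewrite fE; apply: series_ring_monomial => N [j]; rewrite -fE ffunE.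
by case: eqP => _; case: N => [|[|N]] // _; rewrite ?J0.
Qed.

(** Every truncation of a series is a polynomial in the [f i] and so lies in [S]. *)
Lemma series_ring_sub_closure S : is_subalg S -> (forall i, S (f i)) ->
  @series_ring K B J n f `<=` @adic_closure K B J S.
Proof.
move=> SA Sf g [c gc] N; eexists; last exact: gc.
elim/big_ind: _ => [|u v|m _]; [exact: subalg0|exact: subalgD|].
apply: subalgZ => //; elim/big_ind: _ => [|u v|i _].
- exact: subalg1.
- exact: subalgM.
- exact: subalgX.
Qed.

End SeriesRing.
End Subalgebras.

(** * Orders and division of power series *)

Section Orders.
Set Implicit Arguments.
Unset Strict Implicit.
Unset Printing Implicit Defensive.
Import GRing.Theory.
Local Open Scope ring_scope.
Variable K : fieldType.
Implicit Types f g x z : fps K.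

Lemma ord_someP f d :
  ord f = Some d <-> f d != 0 /\ forall k, (k < d)%N -> f k = 0.
Proof.
rewrite /ord; case: pselect => [ex|nex].
  case: ex_minnP => m fm mmin; split=> [[<-]|[fd lt0]].
    split=> // k km; apply/eqP/negPn/negP => /mmin.
    by rewrite leqNgt km.
  congr Some; apply/eqP; rewrite eqn_leq mmin //= leqNgt; apply/negP => /lt0.
  exact/eqP.
by split=> // [[fd _]]; case: nex; exists d.
Qed.

Lemma leqo_ordP N f : leqo N (ord f) <-> forall k, (k < N)%N -> f k = 0.
Proof.
case E: (ord f) => [d|] /=.
  have [fd lt0] := (ord_someP f d).1 E.
  split=> [Nd k kN|lt0N]; first by apply: lt0; apply: leq_trans Nd.
  by rewrite leqNgt; apply/negP => /lt0N/eqP; rewrite (negbTE fd).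
split=> // _ k _; move: E; rewrite /ord; case: pselect => // nex _.
by apply/eqP/negPn/negP => fk; apply: nex; exists k.
Qed.

Lemma ord_neq0 f d : ord f = Some d -> f != 0.
Proof.
by move=> /ord_someP[fd _]; apply/negP => /eqP f0; rewrite f0 eqxx in fd.
Qed.

Lemma neq0_ord f : f != 0 -> exists d, ord f = Some d.
Proof.
case E: (ord f) => [d|]; first by exists d.
case/eqP; apply/fpsP => k.
by apply: (leqo_ordP k.+1 f).1 (ltnSn k); rewrite E.
Qed.

Lemma ord_some_leqo f d : ord f = Some d -> leqo d (ord f).
Proof. by move=> -> /=. Qed.

Lemma leqo_le M N f : (M <= N)%N -> leqo N (ord f) -> leqo M (ord f).
Proof. by case: (ord f) => //= d; apply: leq_trans. Qed.

Lemma leqo_coef f d : leqo d (ord f) -> f d != 0 -> ord f = Some d.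
Proof. by move=> /leqo_ordP lt0 fd; apply/ord_someP. Qed.

Lemma leqo_coef0 f d : leqo d (ord f) -> f d = 0 -> leqo d.+1 (ord f).
Proof.
move=> /leqo_ordP lt0 fd; apply/leqo_ordP => k; rewrite ltnS leq_eqVlt.
by case/orP => [/eqP->|/lt0].
Qed.

Lemma leqo0 N : leqo N (ord (0 : fps K)).
Proof. exact/leqo_ordP. Qed.

Lemma leqoD N f g : leqo N (ord f) -> leqo N (ord g) -> leqo N (ord (f + g)).
Proof.
move=> /leqo_ordP f0 /leqo_ordP g0; apply/leqo_ordP => k kN /=.
by rewrite f0 // g0 // addr0.
Qed.

Lemma leqoZ N a f : leqo N (ord f) -> leqo N (ord (a *: f)).
Proof.
by move=> /leqo_ordP f0; apply/leqo_ordP => k kN /=; rewrite f0 // mulr0.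
Qed.

Lemma leqoN N f : leqo N (ord f) -> leqo N (ord (- f)).
Proof. by rewrite -scaleN1r; apply: leqoZ. Qed.

Lemma leqoB N f g : leqo N (ord f) -> leqo N (ord g) -> leqo N (ord (f - g)).
Proof. by move=> f0 g0; apply/leqoD/leqoN. Qed.

Lemma leqoBC N f g : leqo N (ord (f - g)) -> leqo N (ord (g - f)).
Proof. by move=> /leqoN; rewrite opprB. Qed.

Lemma leqo_trans N f g h :
  leqo N (ord (f - g)) -> leqo N (ord (g - h)) -> leqo N (ord (f - h)).
Proof. by move=> fg gh; have := leqoD fg gh; rewrite addrA subrK. Qed.

Lemma leqoM M N f g :
  leqo M (ord f) -> leqo N (ord g) -> leqo (M + N) (ord (f * g)).
Proof.
move=> /leqo_ordP f0 /leqo_ordP g0; apply/leqo_ordP => k kMN /=.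
apply: big1 => i _; have [iM|Mi] := ltnP i M; first by rewrite f0 // mul0r.
have kN : (k - i < N)%N.
  by rewrite ltn_subLR ?(leq_trans kMN) ?leq_add2r // -ltnS.
by rewrite (g0 _ kN) mulr0.
Qed.

Lemma ordDl f g d : ord f = Some d -> leqo d.+1 (ord g) -> ord (f + g) = Some d.
Proof.
move=> /ord_someP[fd f0] /leqo_ordP g0; apply/ord_someP; split=> [|k kd] /=.
  by rewrite (g0 d) // addr0.
by rewrite f0 // g0 ?addr0 // ltnW.
Qed.

Lemma ord_close f g d : ord f = Some d -> leqo d.+1 (ord (g - f)) ->
  ord g = Some d.
Proof. by move=> fd /(ordDl fd); rewrite addrC subrK. Qed.

Lemma ordM f g a b :
  ord f = Some a -> ord g = Some b -> ord (f * g) = Some (a + b)%N.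
Proof.
move=> fa gb; apply: leqo_coef; first by apply: leqoM; rewrite ?fa ?gb /=.
move: fa gb => /ord_someP[fa amin] /ord_someP[gb bmin].
have aab : (a < (a + b).+1)%N by rewrite ltnS leq_addr.
rewrite /= (bigD1 (Ordinal aab)) //= big1 => [|i ia].
  by rewrite addr0 addKn mulf_neq0.
case: (ltngtP i a) => [/amin->|ai|ia']; first by rewrite mul0r.
  by rewrite (bmin (a + b - i)%N) ?mulr0 // ltn_subLR ?ltn_add2r // -ltnS.
by case/eqP: ia; apply: val_inj.
Qed.

Lemma ordX f d k : ord f = Some d -> ord (f ^+ k) = Some (k * d)%N.
Proof.
move=> fd; elim: k => [|k IH]; last by rewrite exprS mulSn; apply: ordM.
by apply/ord_someP; split=> //; rewrite /= oner_eq0.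
Qed.

Lemma leqoX f k : leqo 1 (ord f) -> leqo k (ord (f ^+ k)).
Proof.
move=> f1; elim: k => [|k IH]; first by case: ord.
by rewrite exprS -add1n; apply: leqoM.
Qed.

Lemma leqoMr N f g : leqo N (ord g) -> leqo N (ord (f * g)).
Proof. by move=> g0; rewrite -[N]add0n; apply: leqoM => //; case: ord. Qed.

Lemma leqo_cancel x d N z :
  ord x = Some d -> leqo (d + N) (ord (x * z)) -> leqo N (ord z).
Proof.
move=> xd; have [->|/neq0_ord[e ze]] := eqVneq z 0; first by move=> _; exact: leqo0.
by rewrite (ordM xd ze) ze /= leq_add2l.
Qed.

Lemma ord_cancel x d e z :
  ord x = Some d -> ord (x * z) = Some (d + e)%N -> ord z = Some e.
Proof.
move=> xd xz; have : x * z != 0 := ord_neq0 xz.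
rewrite mulf_eq0 negb_or => /andP[_ /neq0_ord[e' ze]]; rewrite ze.
by move: xz; rewrite (ordM xd ze) => -[/addnI->].
Qed.

Lemma ord0E f : f 0 != 0 -> ord f = Some 0.
Proof. by move=> f0; apply: leqo_coef => //; case: ord. Qed.

Lemma ord_const (a : K) : a != 0 -> ord (a%:A : fps K) = Some 0.
Proof. by move=> a0; apply: ord0E; rewrite /= mulr1. Qed.

Lemma fps_mulfV f : f 0 != 0 -> f * f^-1 = 1.
Proof. by move=> f0; apply: divrr. Qed.

Definition monomial d : fps K := Fps (fun k => (k == d)%:R).
Definition shift d f : fps K := Fps (fun k => f (k + d)%N).

Lemma monomial_shift d f : leqo d (ord f) -> monomial d * shift d f = f.
Proof.
move=> /leqo_ordP f0; apply/fpsP => k /=.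
have [kd|dk] := ltnP k d.
  rewrite f0 // big1 // => i _.
  have /ltn_eqF-> : (i < d)%N by rewrite (leq_trans _ kd).
  by rewrite mul0r.
have dk1 : (d < k.+1)%N by [].
rewrite (bigD1 (Ordinal dk1)) //= eqxx mul1r subnK // big1 ?addr0 // => i id.
case: eqP => [e|_]; last by rewrite mul0r.
by case/eqP: id; apply: val_inj.
Qed.

(** Both series are multiples of [monomial d], and the cofactor [shift d x] of [x] is invertible. *)
Lemma ord_div x d f :
  ord x = Some d -> leqo d (ord f) -> exists z, x * z = f.
Proof.
move=> xd fd; exists ((shift d x)^-1 * shift d f).
rewrite -{1}(monomial_shift (ord_some_leqo xd)) -mulrA mulVKr ?monomial_shift //.
by have [x0 _] := (ord_someP x d).1 xd.
Qed.

End Orders.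

(** * Closed subalgebras of the power series ring *)

Section Closure.
Set Implicit Arguments.
Unset Strict Implicit.
Unset Printing Implicit Defensive.
Import GRing.Theory.
Local Open Scope ring_scope.
Variable K : fieldType.
Implicit Types (f g x z : fps K) (S T : set (fps K)).

Local Notation cl := (adic_closure (@ord_filtration K)).

Lemma sub_closure S : S `<=` cl S.
Proof. by move=> f Sf N; exists f => //; rewrite subrr; apply: leqo0. Qed.

Lemma closure_sub S T : S `<=` T -> cl S `<=` cl T.
Proof. by move=> ST f Sf N; have [s /ST] := Sf N; exists s. Qed.

Lemma closureK S : cl (cl S) `<=` cl S.
Proof.
move=> f Sf N; have [g Sg fg] := Sf N; have [h Sh gh] := Sg N.
by exists h => //; apply: leqo_trans fg gh.
Qed.

Lemma closure_subalg S : is_subalg S -> is_subalg (cl S).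
Proof.
move=> SA; split=> [|a u v Su Sv N|u v Su Sv N].
- by apply: sub_closure; apply: subalg1.
- have [s Ss us] := Su N; have [t St vt] := Sv N; exists (a *: s + t).
    by apply: subalgD => //; apply: subalgZ.
  rewrite opprD addrACA -scalerBr; apply: leqoD => //; exact: leqoZ.
- have [s Ss us] := Su N; have [t St vt] := Sv N; exists (s * t).
    exact: subalgM.
  apply: (@leqo_trans _ _ _ (s * v)); rewrite -?mulrBr -?mulrBl.
    by rewrite mulrC; apply: leqoMr.
  exact: leqoMr.
Qed.

(* With [f = a (1 - n)], [a] a nonzero constant and [n] of positive order,
   the inverse of [f] is the limit of [a^-1 (1 + n + ... + n^(N-1))]. *)
Lemma closed_inv S f : is_subalg S -> cl S `<=` S -> S f -> f 0 != 0 -> S f^-1.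
Proof.
move=> SA clS Sf f0; apply: clS => N.
set n := 1 - (f 0)^-1 *: f.
have Sn : S n by apply: subalgB => //; [exact: subalg1|exact: subalgZ].
have n1 : leqo 1 (ord n).
  by apply/leqo_ordP => [[|//]] _ /=; rewrite mulVf // subrr.
exists ((f 0)^-1 *: \sum_(i < N) n ^+ i).
  apply: subalgZ => //; elim/big_ind: _ => [|u v|i _].
  - exact: subalg0.
  - exact: subalgD.
  - exact: subalgX.
set s := _ *: _; have fs : f * s = 1 - n ^+ N.
  rewrite -opprB subrX1 -mulNr opprB /n opprB addrC subrK.
  by rewrite /s -scalerAr scalerAl.
have -> : f^-1 - s = f^-1 * n ^+ N.
  apply: (mulfI (ord_neq0 (ord0E f0))).
  by rewrite mulrBr fs mulrA fps_mulfV // mul1r opprB addrC subrK.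
exact/leqoMr/leqoX.
Qed.

End Closure.

(** * One-branch Arf rings and blow-ups *)

Section OneBranch.
Set Implicit Arguments.
Unset Strict Implicit.
Unset Printing Implicit Defensive.
Import GRing.Theory.
Local Open Scope ring_scope.
Variable K : fieldType.
Implicit Types (f g x z : fps K) (C T E : set (fps K)) (M : nat -> nat).

Local Notation cl := (adic_closure (@ord_filtration K)).

Definition arf_branch C : Prop :=
  is_subalg C /\ forall x, C x -> x != 0 -> is_subalg (colon x C).

Lemma branch_ring_gen n (y : 'I_n -> fps K) i :
  (forall i, leqo 1 (ord (y i))) -> branch_ring y (y i).
Proof.
move=> y1; apply: series_ring_gen => [|N|//]; last exact: leqo0.
by apply/funext => f; apply/propext; split=> // _; rewrite /ord_filtration /=; case: ord.
Qed.

Lemma colon_closed C x d : cl C `<=` C -> ord x = Some d ->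
  cl (colon x C) `<=` colon x C.
Proof.
move=> clC xd f fC; apply: clC => N; have [s sC fs] := fC N.
by exists (x * s) => //; rewrite -mulrBr; apply: leqoMr.
Qed.

(** Dividing twice is dividing by the product, so the Arf property of [C] applies again. *)
Lemma colon_arf C x : arf_branch C -> C x -> x != 0 -> arf_branch (colon x C).
Proof.
move=> [CA Carf] Cx x0; split=> [|z Cxz z0]; first exact: Carf.
have -> : colon z (colon x C) = colon (x * z) C.
  by apply/funext => w; rewrite /colon /= mulrA.
by apply: Carf => //; rewrite mulf_neq0.
Qed.

(** Inverse of a blow-up step: if the blow-up of T along an element [x] of least positive order lies
    in [E], then T lies in K + x E. *)
Definition constants_plus x E : set (fps K) :=
  [set f | exists (a : K) z, E z /\ f = a%:A + x * z].

Lemma constants_plus_subalg x E : is_subalg E -> E x ->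
  is_subalg (constants_plus x E).
Proof.
move=> EA Ex.
split.
- exists 1, 0; split; first exact: subalg0.
  by rewrite mulr0 addr0 scale1r.
- move=> a _ _ [b [z [Gz ->]]] [b' [z' [Gz' ->]]].
  exists (a * b + b'), (a *: z + z'); split.
    by apply: subalgD => //; apply: subalgZ.
  by rewrite scalerDl scalerDr scalerA mulrDr scalerAr addrACA.
- move=> _ _ [b [z [Gz ->]]] [b' [z' [Gz' ->]]].
  exists (b * b'), (b *: z' + b' *: z + z * (x * z')); split.
    apply: subalgD => //; last by apply: subalgM => //; apply: subalgM.
    by apply: subalgD => //; apply: subalgZ.
  rewrite mulrDl !mulrDr -!scalerAl -!scalerAr !mul1r mulr1 scalerA.
  by rewrite !addrA mulrA.
Qed.

(** The blow-up is enclosed from two sides. Dividing a closed Arf ring that contains [T] by [x]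
    gives a ring that contains [T'], which will produce values; and [T] sits in K + x T', which will
    exclude values. *)
Lemma blowup_spec T T' m :
  is_blowup T T' -> least (positive_orders T) m ->
  exists x, [/\ [/\ T x, ord x = Some m, (0 < m)%N & T' x],
    forall C, cl C `<=` C -> arf_branch C -> T `<=` C -> T' `<=` colon x C
  & T `<=` constants_plus x T'].
Proof.
move=> [k [y [x [d [y1 TE [Tx xd] [[d0 _] dmin] T'E]]]]] [[m0 [r Tr rm]] mmin].
have : d = m.
  apply/eqP; rewrite eqn_leq dmin ?mmin //; first by split=> //; exists x.
  by split=> //; exists r.
move=> dm; move: xd; rewrite {}dm => xm.
have least_y i : leqo m (ord (y i)).
  case E: (ord (y i)) => [e|] //=; apply: mmin; split.
    by have := y1 i; rewrite E.
  by exists (y i) => //; rewrite TE; apply: branch_ring_gen.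
pose G := [set x] `|` [set z | exists i, x * z = y i].
have GA := generated_subalg G.
have Gx : generated_subalgebra G x by apply: sub_generated; left.
have clG : cl (generated_subalgebra G) = T' by rewrite T'E.
exists x; split; first by split=> //; rewrite -clG; apply: sub_closure.
  move=> C clC Carf TC; have x0 := ord_neq0 xm.
  have colA : is_subalg (colon x C) by apply: Carf.2 => //; apply: TC.
  rewrite -clG; apply: subset_trans (colon_closed clC xm).
  apply: closure_sub; apply: generated_sub => // z [->|[i xz]].
    by apply: subalgM; [exact: Carf.1|exact: TC|exact: TC].
  by rewrite /colon /= xz; apply: TC; rewrite TE; apply: branch_ring_gen.
move=> g; rewrite TE.
pose S := constants_plus x (generated_subalgebra G).
have SA : is_subalg S by apply: constants_plus_subalg.
have Sy i : S (y i).
  have [z xz] := ord_div xm (least_y i); exists 0, z; split.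
    by apply: sub_generated; right; exists i.
  by rewrite scale0r add0r.
(* The approximations of [g] have the form a + x z. As [x] has positive order, a is the constant
   term of [g], so the quotient of [g] minus this constant by [x] is a limit of such z and lies in
   [T']. *)
move=> /(series_ring_sub_closure SA Sy) gS.
have g0 N : (0 < N)%N -> exists2 z, generated_subalgebra G z &
    leqo N (ord (g - (g 0%N)%:A - x * z)).
  move=> N0; have [_ [a [z [Gz ->]]] gaz] := gS N; exists z => //.
  suff -> : g 0%N = a by rewrite -addrA -opprD.
  have /leqo_ordP/(_ 0%N N0)/= := gaz.
  have [_ x0] := (ord_someP x m).1 xm.
  rewrite big_ord1 x0 // mul0r mulr1 addr0 => /eqP; rewrite subr_eq0.
  by move/eqP.
have [z1 xz1] : exists z, x * z = g - (g 0%N)%:A.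
  apply: (ord_div xm); have [z _ gz] := g0 m m0.
  rewrite -(subrK (x * z) (g - _)); apply: leqoD => //.
  by rewrite mulrC; apply: leqoMr; rewrite xm /=.
exists (g 0%N), z1; split; last by rewrite xz1 addrC subrK.
(* Division by [x] costs [m] orders of precision. *)
rewrite -clG => N; have [|z Gz] := g0 (m + N)%N; first by rewrite addn_gt0 m0.
rewrite -xz1 -mulrBr => /(leqo_cancel xm); by exists z.
Qed.

(** The induction generalizes over [C], since its step replaces [C] by [colon x C], which is again
    closed and Arf and contains the next blow-up. *)
Lemma is_blowup_values (T : nat -> set (fps K)) M :
  (forall j, (0 < j)%N ->
     is_blowup (T j) (T j.+1) /\ least (positive_orders (T j)) (M j)) ->
  forall m j, (0 < j)%N -> forall C, cl C `<=` C -> arf_branch C -> T j `<=` C ->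
  exists2 f, C f & ord f = Some (\sum_(j <= i < j + m) M i)%N.
Proof.
move=> bl; elim=> [|m IH] j j0 C clC Carf TC.
  rewrite addn0 big_geq //; exists 1; first exact: subalg1 Carf.1.
  by apply: ord0E; rewrite /= oner_eq0.
have [blj lej] := bl j j0.
have [x [[Tx xm m0 _] xC _]] := blowup_spec blj lej.
have x0 := ord_neq0 xm; have Cx := TC _ Tx.
have [f Cf fm] := IH j.+1 isT _ (colon_closed clC xm)
  (colon_arf Carf Cx x0) (xC _ clC Carf TC).
exists (x * f) => //; rewrite addnS big_nat_recl ?leq_addr //.
by rewrite (ordM xm fm) big_add1.
Qed.

(** A non-unit of K + x E is x e with e in [E], and dividing by it amounts to dividing [E] by e;
    dividing by a unit gives the ring itself. The second case is why closure under inverses is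
    carried along. *)
Lemma constants_plus_arf x m E : ord x = Some m -> (0 < m)%N -> E x ->
  (forall f, E f -> f 0%N != 0 -> E f^-1) -> arf_branch E ->
  arf_branch (constants_plus x E) /\
  (forall f, constants_plus x E f -> f 0%N != 0 -> constants_plus x E f^-1).
Proof.
move=> xm m0 Ex Einv [EA Earf].
have Ek (a : K) : E a%:A by apply: subalgZ => //; apply: subalg1.
have FE : constants_plus x E `<=` E.
  by move=> _ [a [z [Ez ->]]]; apply: subalgD => //; apply: subalgM.
have x00 : x 0%N = 0 by have [_] := (ord_someP x m).1 xm; apply.
have at0 (a : K) z : (a%:A + x * z) 0%N = a.
  by rewrite /= big_ord1 x00 mul0r mulr1 addr0.
have FA : is_subalg (constants_plus x E) by apply: constants_plus_subalg.
have Finv f : constants_plus x E f -> f 0%N != 0 -> constants_plus x E f^-1.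
  move=> Ff f0; have Ef := FE _ Ff; case: Ff => a [z [Ez fE]].
  have fa : f 0%N = a by rewrite fE at0.
  (* From f = a + x z follows f^-1 = a^-1 - x a^-1 z f^-1. *)
  exists a^-1, (- (a^-1 *: (z * f^-1))); split.
    rewrite -scaleNr; apply: subalgZ => //; apply: subalgM => //; exact: Einv.
  apply: (mulfI (ord_neq0 (ord0E f0))); rewrite fps_mulfV //.
  have a0 : a != 0 by rewrite -fa.
  rewrite mulrDr mulrN -!scalerAr mulr1 mulrN mulrCA mulrCA -scalerAr.
  rewrite [f * (x * _)]mulrCA (mulrCA f) fps_mulfV // mulr1.
  by rewrite -scalerBr fE addrK scalerA mulVf // scale1r.
split=> //; split=> // f Ff f_neq0.
have [f0|f0] := eqVneq (f 0%N) 0.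
  case: Ff => a [e [Ee fE]]; move: f0; rewrite fE at0 => a0.
  have {}fE : f = x * e by rewrite fE a0 scale0r add0r.
  have -> : colon (a%:A + x * e) (constants_plus x E) = colon e E.
    rewrite a0 scale0r add0r; apply/funext => w; apply/propext; split.
      (* The constant term of x e w vanishes, which forces b = 0 and lets [x] be cancelled. *)
      move=> [b [z [Ez]]] xew; have b0 : b = 0.
        have := at0 b z; rewrite -xew -mulrA => <-.
        by rewrite /= big_ord1 x00 mul0r.
      move: xew; rewrite b0 scale0r add0r -mulrA.
      by move/(mulfI (ord_neq0 xm)) => ewz; rewrite /colon /= ewz.
    by move=> Eew; exists 0, (e * w); rewrite scale0r add0r mulrA.
  by apply: Earf => //; apply: contra f_neq0 => /eqP e0; rewrite fE e0 mulr0.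
suff -> : colon f (constants_plus x E) = constants_plus x E by [].
apply/funext => w; apply/propext; split=> [Ffw|Fw]; last exact: subalgM.
by rewrite -[w]mul1r -(fps_mulfV f0) mulrAC mulrC; apply: subalgM => //; apply: Finv.
Qed.

(** Descending construction. At index l + 1 the whole power series ring serves, since from there on
    all multiplicities are 1 and partial sums reach every order; each step down adds a layer K + x E
    and with it one term of the sum. *)
Lemma arf_branch_envelope (T : nat -> set (fps K)) M l :
  (forall j, (0 < j)%N ->
     is_blowup (T j) (T j.+1) /\ least (positive_orders (T j)) (M j)) ->
  (forall j, (l < j)%N -> M j = 1%N) ->
  forall m j, (0 < j)%N -> (j + m = l.+1)%N ->
  exists E, [/\ arf_branch E, forall f, E f -> f 0%N != 0 -> E f^-1, T j `<=` E
    & forall f d, E f -> ord f = Some d ->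
        exists k, d = (\sum_(j <= i < j + k) M i)%N].
Proof.
move=> bl M1; elim=> [|m IH] j j0; rewrite ?addn0 => jm.
  exists setT; split=> // f d _ _; exists d; rewrite jm.
  rewrite (eq_big_nat _ _ (F2 := fun=> 1%N)) => [|i /andP[li _]]; last exact: M1.
  by rewrite sum_nat_const_nat addKn muln1.
have [E [Earf Einv TE Eval]] := IH j.+1 isT (etrans (addSnnS j m) jm).
have [blj lej] := bl j j0.
have [x [[Tx xm m0 T'x] _ Tsub]] := blowup_spec blj lej.
have [Farf Finv] := constants_plus_arf xm m0 (TE _ T'x) Einv Earf.
exists (constants_plus x E); split=> //.
  by move=> g /Tsub[a [z [T'z ->]]]; exists a, z; split=> //; apply: TE.
move=> _ d [a [z [Ez ->]]] fd.
(* A nonzero constant term gives order 0, the empty sum; otherwise the factor [x] puts [M j] in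
   front of a sum from the next index. *)
have [a0|a0] := eqVneq a 0; last first.
  exists 0%N; rewrite addn0 big_geq //.
  have : ord (a%:A + x * z) = Some 0%N.
    apply: ordDl; first exact: ord_const.
    by apply: (leqo_le m0); rewrite mulrC; apply: leqoMr; rewrite xm /=.
  by rewrite fd => -[].
move: fd; rewrite a0 scale0r add0r => fd; have := ord_neq0 fd.
rewrite mulf_eq0 negb_or => /andP[_ /neq0_ord[e ze]].
have [k ek] := Eval _ _ Ez ze; exists k.+1.
move: fd; rewrite (ordM xm ze) => -[<-].
by rewrite addnS big_nat_recl ?leq_addr // ek big_add1.
Qed.

End OneBranch.

(** * Two-branch Arf rings and their projections *)

Section TwoBranches.
Set Implicit Arguments.
Unset Strict Implicit.
Unset Printing Implicit Defensive.
Import GRing.Theory.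
Local Open Scope ring_scope.
Variable K : fieldType.
Local Notation B := (fps K * fps K)%type.
Implicit Types (A R : set B) (x y z : B) (f g : fps K) (E : set (fps K)).

Local Notation cl := (adic_closure (@ord_filtration K)).

(** Working form of [is_arf] for rings containing the constants, with finite values expressed by
    nonzero components. *)
Definition arf_ring A : Prop :=
  is_subalg A /\
  forall x, A x -> x.1 != 0 -> x.2 != 0 -> is_subalg (colon x A).

(** A multiple of [x] automatically has at least the value of [x]. *)
Lemma colonE A x (a : nat * nat) : nu x = (Some a.1, Some a.2) ->
  [set z : B | exists2 r, A r /\ nu_ge a r & x * z = r] = colon x A.
Proof.
move=> [x1 x2]; apply/funext => z; apply/propext; split=> [[r [Ar _] xz]|Axz].
  by rewrite /colon /= xz.
exists (x * z) => //; split=> //.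
by split; rewrite /= mulrC; apply: leqoMr; rewrite ?x1 ?x2 /=.
Qed.

Lemma is_arf_ring A : is_arf A -> (forall a : K, A a%:A) -> arf_ring A.
Proof.
move=> [Aring Aarf] Ak; have AA := subring_subalg Aring Ak.
split=> // x Ax /neq0_ord[a1 x1] /neq0_ord[a2 x2].
have xa : nu x = (Some (a1, a2).1, Some (a1, a2).2) by rewrite /nu x1 x2.
have := Aarf x (a1, a2) Ax xa; rewrite (colonE A xa) => /subring_subalg; apply.
by move=> a; rewrite /colon /= mulrC mulr_algl; apply: subalgZ.
Qed.

Lemma arf_ring_is_arf A : arf_ring A -> is_arf A.
Proof.
move=> [AA Aarf]; split=> [|x a Ax xa]; first exact: subalg_subring.
rewrite (colonE A xa); apply: subalg_subring; case: xa => x1 x2.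
by apply: Aarf => //; [exact: ord_neq0 x1|exact: ord_neq0 x2].
Qed.

(** The Arf conditions pass to intersections: each ring of the family contains [R], hence the
    constants, and an [x] in the closure belongs to all of them. *)
Lemma arf_closure_arf R : (forall a : K, R a%:A) -> arf_ring (arf_closure R).
Proof.
move=> Rk; have arfM A : is_arf A /\ R `<=` A -> arf_ring A.
  by move=> [Aarf RA]; apply: is_arf_ring => // a; apply: RA.
split=> [|x Ax x1 x2]; split.
- by move=> A /arfM[AA _]; apply: subalg1.
- move=> a u v Au Av A hA; have [[_ AL _] _] := arfM A hA.
  by apply: AL; [exact: Au|exact: Av].
- move=> u v Au Av A hA; have [AA _] := arfM A hA.
  by apply: subalgM => //; [exact: Au|exact: Av].
- by rewrite /colon /= mulr1.
- move=> a u v Au Av A hA; have [_ /(_ x (Ax A hA) x1 x2)[_ AL _]] := arfM A hA.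
  by apply: AL; [exact: Au|exact: Av].
- move=> u v Au Av A hA; have [_ /(_ x (Ax A hA) x1 x2)[_ _ AM]] := arfM A hA.
  by apply: AM; [exact: Au|exact: Av].
Qed.

Lemma sub_arf_closure R : R `<=` arf_closure R.
Proof. by move=> r Rr A [_]; apply. Qed.

Definition prod_set E1 E2 : set B := [set x | E1 x.1 /\ E2 x.2].

Lemma prod_subalg E1 E2 :
  is_subalg E1 -> is_subalg E2 -> is_subalg (prod_set E1 E2).
Proof.
move=> [E11 E1L E1M] [E21 E2L E2M]; split=> //.
  by move=> a u v [? ?] [? ?]; split; [exact: E1L|exact: E2L].
by move=> u v [? ?] [? ?]; split; [exact: E1M|exact: E2M].
Qed.

Lemma prod_arf E1 E2 :
  arf_branch E1 -> arf_branch E2 -> arf_ring (prod_set E1 E2).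
Proof.
move=> [E1A E1arf] [E2A E2arf]; split; first exact: prod_subalg.
move=> x [x1 x2] x10 x20.
by apply: (@prod_subalg (colon x.1 E1) (colon x.2 E2)); [exact: E1arf|exact: E2arf].
Qed.

(** Exchanging the branches lets lemmas stated for the first component serve the second. *)
Definition swap_set A : set B := [set x | A (x.2, x.1)].

Lemma swap_subalg A : is_subalg A -> is_subalg (swap_set A).
Proof.
move=> [A1 AL AM]; split=> //.
  by move=> a u v Au Av; have := AL a _ _ Au Av.
by move=> u v Au Av; have := AM _ _ Au Av.
Qed.

Lemma swap_arf A : arf_ring A -> arf_ring (swap_set A).
Proof.
move=> [AA Aarf]; split=> [|x Ax x1 x2]; first exact: swap_subalg.
exact: swap_subalg (Aarf (x.2, x.1) Ax x2 x1).
Qed.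

Lemma fst_subalg A : is_subalg A -> is_subalg (fst @` A).
Proof.
move=> [A1 AL AM]; split; first by exists 1.
  by move=> a _ _ [u Au <-] [v Av <-]; exists (a *: u + v) => //; apply: AL.
by move=> _ _ [u Au <-] [v Av <-]; exists (u * v) => //; apply: AM.
Qed.

(* Division in A only sees elements of comparable values; dividing by an element
   of least second order loses nothing in the first projection. *)
Lemma least_second_order A d : is_subalg A ->
  (exists2 b, A b & leqo d.+1 (ord b.1) /\ b.2 != 0) ->
  (exists2 a, A a & ord a.1 = Some d) ->
  exists2 a, A a /\ ord a.1 = Some d & a.2 != 0 /\
    forall b, A b -> leqo d (ord b.1) -> exists z, b = a * z.
Proof.
move=> AA [b0 Ab0 [b01 b02]] [a0 Aa0 a01].
pose P e := `[< exists2 a, A a & nu a = (Some d, Some e) >].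
have exP : exists e, P e.
  have [a02|] := eqVneq a0.2 0; last first.
    by move=> /neq0_ord[e a02]; exists e; apply/asboolP; exists a0; rewrite // /nu a01 a02.
  (* When [a0.2] is zero, adding [b0] makes the second order finite and keeps the first order equal
     to [d]. *)
  have [e b0e] := neq0_ord b02; exists e; apply/asboolP; exists (a0 + b0).
    exact: subalgD.
  by rewrite /nu /= a02 add0r b0e (ordDl a01 b01).
case: (ex_minnP exP) => e /asboolP[a Aa [a1 a2]] emin.
exists a => //; split; first exact: ord_neq0 a2.
move=> b Ab b1; suff b2 : leqo e (ord b.2).
  have [z1 z1E] := ord_div a1 b1; have [z2 z2E] := ord_div a2 b2.
  by exists (z1, z2); rewrite [LHS]surjective_pairing -z1E -z2E.
case E: (ord b.2) => [e'|] //=; rewrite leqNgt; apply/negP => lt.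
have small c : A c -> ord c.1 = Some d -> ord c.2 = Some e' -> False.
  move=> Ac c1 c2; have /emin : P e' by apply/asboolP; exists c; rewrite // /nu c1 c2.
  by rewrite leqNgt lt.
(* A second order below [e] contradicts minimality directly if [b.1] has order [d], and after adding
   [a] if it has larger order. *)
have [bd|/eqP bd] := eqVneq (b.1 d) 0; last first.
  by apply: (small b) => //; apply: leqo_coef => //; apply/eqP.
apply: (small (b + a)); first exact: subalgD.
  by rewrite /= addrC; apply: ordDl => //; apply: leqo_coef0.
by apply: ordDl => //; rewrite a2.
Qed.

(** An element [f] of the closure is matched with some [a] in [A] of the same first order that
    divides all elements of [A] of at least that first order. Then f = a.1 u with [u] a unit of [D],
    the closed projection of [colon a A], and dividing by [f] gives [D] again. *)
Lemma fst_closure_arf A : arf_ring A ->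
  (forall N, exists2 b, A b & leqo N (ord b.1) /\ b.2 != 0) ->
  arf_branch (cl (fst @` A)).
Proof.
move=> [AA Aarf] Abig; have CA := closure_subalg (fst_subalg AA).
split=> // f Cf /neq0_ord[d fd].
have [a [Aa a1] [a2 adiv]] : exists2 a, A a /\ ord a.1 = Some d &
    a.2 != 0 /\ forall b, A b -> leqo d (ord b.1) -> exists z, b = a * z.
  apply: least_second_order => //.
  have [_ [a Aa <-] fa] := Cf d.+1; exists a => //.
  by apply: ord_close fd _; apply: leqoBC.
have a10 := ord_neq0 a1; have DA := Aarf a Aa a10 a2.
set D := cl (fst @` colon a A).
have DA1 : is_subalg D by apply/closure_subalg/fst_subalg.
have DE (z : fps K) : D z <-> cl (fst @` A) (a.1 * z).
  split=> Dz N.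
    have [_ [w Aaw <-] zw] := Dz N; exists (a.1 * w.1); first by exists (a * w).
    by rewrite -mulrBr; apply: leqoMr.
  (* The extra precision [d] pays for the division by [a.1] and makes the first order of [b] at
     least [d]. *)
  have [_ [b Ab <-] azb] := Dz (d + N)%N.
  have [|w bE] := adiv b Ab.
    have -> : b.1 = a.1 * z - (a.1 * z - b.1) by rewrite opprB addrC subrK.
    apply: leqoB; first by rewrite mulrC; apply: leqoMr; rewrite a1 /=.
    exact: leqo_le (leq_addr _ _) azb.
  exists w.1; first by exists w => //; rewrite /colon /= -bE.
  by apply: (leqo_cancel a1); rewrite mulrBr; move: azb; rewrite bE.
have [u fE] : exists u, a.1 * u = f by apply: (ord_div a1); rewrite fd /=.
have Du : D u by apply/DE; rewrite fE.
have u0 : u 0%N != 0.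
  have /ord_someP[] // : ord u = Some 0%N.
  by apply: (ord_cancel a1); rewrite fE addn0.
have Dv : D u^-1 by apply: closed_inv => //; exact: closureK.
suff -> : colon f (cl (fst @` A)) = D by [].
apply/funext => z; apply/propext; rewrite /colon /= -fE -mulrA.
split=> [/DE Duz|Dz]; last by apply/DE; apply: (subalgM DA1).
by rewrite -[z](mulKr (x := u)) //; exact: (subalgM DA1 Dv Duz).
Qed.

Lemma nu_filtration0 : @nu_filtration K 0 = setT.
Proof.
by apply/funext => x; apply/propext; split=> // _; split; rewrite /=; case: ord.
Qed.

Lemma curve_ring_const n (phi psi : 'I_n -> fps K) (a : K) :
  curve_ring phi psi a%:A.
Proof.
apply: series_ring_const; first exact: nu_filtration0.
by move=> N; split; apply: leqo0.
Qed.

Lemma curve_ring_gen n (phi psi : 'I_n -> fps K) i :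
  (forall i, leqo 1 (ord (phi i)) /\ leqo 1 (ord (psi i))) ->
  curve_ring phi psi (phi i, psi i).
Proof.
move=> pos.
apply: (series_ring_gen (f := fun i => (phi i, psi i) : B)) => //.
  exact: nu_filtration0.
by move=> N; split; apply: leqo0.
Qed.

Lemma fst_exp x k : (x ^+ k).1 = x.1 ^+ k.
Proof. by elim: k => // k IH; rewrite !exprS /= IH. Qed.

Lemma snd_exp x k : (x ^+ k).2 = x.2 ^+ k.
Proof. by elim: k => // k IH; rewrite !exprS /= IH. Qed.

Lemma curve_ring_branches n (phi psi : 'I_n -> fps K) :
  curve_ring phi psi `<=` prod_set (branch_ring phi) (branch_ring psi).
Proof.
move=> x [c xc]; split; exists c => N; have [x1 x2] := xc N.
  move: x1; rewrite /= (big_morph fst (id1 := 0) (op1 := +%R)) //.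
  congr (leqo N (ord (_ - _))); apply: eq_bigr => m _ /=; congr (_ *: _).
  rewrite (big_morph fst (id1 := 1) (op1 := *%R)) //.
  by apply: eq_bigr => i _; rewrite fst_exp.
move: x2; rewrite /= (big_morph snd (id1 := 0) (op1 := +%R)) //.
congr (leqo N (ord (_ - _))); apply: eq_bigr => m _ /=; congr (_ *: _).
rewrite (big_morph snd (id1 := 1) (op1 := *%R)) //.
by apply: eq_bigr => i _; rewrite snd_exp.
Qed.

Lemma fst_values A n (phi : 'I_n -> fps K) M m : arf_ring A ->
  (forall N, exists2 b, A b & leqo N (ord b.1) /\ b.2 != 0) ->
  (forall i, (fst @` A) (phi i)) ->
  is_multiplicity_sequence (branch_ring phi) M ->
  exists2 a, A a & ord a.1 = Some (\sum_(1 <= j < 1 + m) M j)%N.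
Proof.
move=> Aarf Abig Aphi [T T1 bl].
have [|f Cf fm] := @is_blowup_values _ _ _ bl m 1%N isT _ (@closureK _ _)
  (fst_closure_arf Aarf Abig).
  rewrite T1; apply: series_ring_sub_closure => //; exact: fst_subalg Aarf.1.
(* An approximation of [f] beyond its order has the same order, which leads from the closure back to
   [A]. *)
have [_ [a Aa <-] fa] := Cf (\sum_(1 <= j < 1 + m) M j).+1%N.
by exists a => //; apply: ord_close fm _; apply: leqoBC.
Qed.

Lemma leqo_next f N : leqo N (ord f) -> ord f <> Some N -> leqo N.+1 (ord f).
Proof.
case: (ord f) => //= d; rewrite leq_eqVlt => /orP[/eqP->//|//].
Qed.

(** * Separating the two components *)

Section Splitting.
Variable s : nat.

Definition diagonal_below A : Prop := forall a, A a -> ord a.1 <> ord a.2 ->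
  leqo s (ord a.1) /\ leqo s (ord a.2).

Definition splits_at A : Prop := exists y e g : B, [/\ A y, A e & A g] /\
  [/\ nu y = (Some s, Some s), ord e.1 = Some s /\ leqo s.+1 (ord e.2)
    & ord g.2 = Some s /\ leqo s.+1 (ord g.1)].

(** If [g.1] has order above [s], then e + g has value (s, s). Otherwise [g] itself has this value,
    and a combination with [e] cancels the leading term of the first component. *)
Lemma splits_atP A (e g : B) : is_subalg A -> diagonal_below A -> A e -> A g ->
  ord e.1 = Some s -> leqo s.+1 (ord e.2) -> ord g.2 = Some s -> splits_at A.
Proof.
move=> AA diag Ae Ag e1 e2 g2.
have [g1|g1] := pselect (ord g.1 = Some s); last first.
  have [g1s _] : leqo s (ord g.1) /\ leqo s (ord g.2) by apply: diag; rewrite ?g2.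
  have {}g1 := leqo_next g1s g1.
  exists (e + g), e, g; split; first by split=> //; apply: subalgD.
  by split=> //; rewrite /nu /= (ordDl e1 g1) addrC (ordDl g2 e2).
have [es _] := (ord_someP _ _).1 e1; have [gs _] := (ord_someP _ _).1 g1.
set b := - (e.1 s / g.1 s); have b0 : b != 0 by rewrite oppr_eq0 mulf_neq0 ?invr_eq0.
exists g, e, (b *: g + e); split.
  by split=> //; case: AA => _ AL _; apply: AL.
split=> //; first by rewrite /nu g1 g2.
split; rewrite /=.
  apply: ordDl => //; have [gs2 g20] := (ord_someP _ _).1 g2.
  by apply/ord_someP; split=> [|k ks] /=; [rewrite mulf_neq0|rewrite g20 // mulr0].
apply: leqo_coef0; first by apply: leqoD; [apply: leqoZ; rewrite g1 /=|rewrite e1 /=].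
by rewrite /= /b mulNr divfK // addNr.
Qed.

(** The quotients u = e / y and v = g / y are units in one component and of positive order in the
    other. Their high powers act as approximate idempotents: z1 u^k + z2 v^k takes its first order
    from z1 = a1 / y and its second from z2 = a2 / y. *)
Lemma split_values A d1 d2 a1 a2 : arf_ring A -> diagonal_below A ->
  splits_at A -> (s <= d1)%N -> (s <= d2)%N ->
  A a1 -> ord a1.1 = Some d1 -> A a2 -> ord a2.2 = Some d2 ->
  exists2 a, A a & nu a = (Some d1, Some d2).
Proof.
move=> [AA Aarf] diag [y [e [g [[Ay Ae Ag] [[y1 y2] [e1 e2] [g2 g1]]]]]].
move=> sd1 sd2 Aa1 a1d Aa2 a2d.
have QA := Aarf y Ay (ord_neq0 y1) (ord_neq0 y2).
have div a : A a -> leqo s (ord a.1) -> leqo s (ord a.2) ->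
    exists2 z, colon y A z & a = y * z.
  move=> Aa l1 l2; have [z1 z1E] := ord_div y1 l1; have [z2 z2E] := ord_div y2 l2.
  have E : a = y * (z1, z2) by rewrite [LHS]surjective_pairing -z1E -z2E.
  by exists (z1, z2) => //; rewrite /colon /= -E.
(* The order of the other component either equals the known one or is at least [s] by [diag]. *)
have [z1 Qz1 a1E] : exists2 z, colon y A z & a1 = y * z.
  apply: div => //; first by rewrite a1d.
  have [<-|ne] := pselect (ord a1.1 = ord a1.2); first by rewrite a1d.
  by have [] := diag _ Aa1 ne.
have [z2 Qz2 a2E] : exists2 z, colon y A z & a2 = y * z.
  apply: div => //; last by rewrite a2d.
  have [->|ne] := pselect (ord a2.1 = ord a2.2); first by rewrite a2d.
  by have [] := diag _ Aa2 ne.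
have [u Qu eE] : exists2 z, colon y A z & e = y * z.
  by apply: div => //; [rewrite e1 /=|apply: leqo_le e2].
have [v Qv gE] : exists2 z, colon y A z & g = y * z.
  by apply: div => //; [apply: leqo_le g1|rewrite g2 /=].
have u1 : ord u.1 = Some 0%N by apply: (ord_cancel y1); rewrite addn0 -e1 eE.
have v2 : ord v.2 = Some 0%N by apply: (ord_cancel y2); rewrite addn0 -g2 gE.
have u2 : leqo 1 (ord u.2) by apply: (leqo_cancel y2); rewrite addn1; move: e2; rewrite eE.
have v1 : leqo 1 (ord v.1) by apply: (leqo_cancel y1); rewrite addn1; move: g1; rewrite gE.
have z1d : ord z1.1 = Some (d1 - s)%N.
  by apply: (ord_cancel y1); rewrite subnKC // -a1d a1E.
have z2d : ord z2.2 = Some (d2 - s)%N.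
  by apply: (ord_cancel y2); rewrite subnKC // -a2d a2E.
(* This exceeds d1 - s and d2 - s, so the unwanted summand never reaches the leading term. *)
pose k := (d1 + d2).+1.
exists (y * (z1 * u ^+ k + z2 * v ^+ k)).
  suff : colon y A (z1 * u ^+ k + z2 * v ^+ k) by [].
  by apply: subalgD => //; apply: subalgM => //; apply: subalgX.
have w1 : ord (z1.1 * u.1 ^+ k + z2.1 * v.1 ^+ k) = Some (d1 - s)%N.
  apply: ordDl; first by rewrite (ordM z1d (ordX k u1)) muln0 addn0.
  apply/leqoMr/(leqo_le _ (leqoX k v1)).
  by rewrite ltnS (leq_trans (leq_subr _ _)) // leq_addr.
have w2 : ord (z1.2 * u.2 ^+ k + z2.2 * v.2 ^+ k) = Some (d2 - s)%N.
  rewrite addrC; apply: ordDl; first by rewrite (ordM z2d (ordX k v2)) muln0 addn0.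
  apply/leqoMr/(leqo_le _ (leqoX k u2)).
  by rewrite ltnS (leq_trans (leq_subr _ _)) // leq_addl.
by rewrite /nu /= !fst_exp !snd_exp (ordM y1 w1) (ordM y2 w2) !subnKC.
Qed.

Lemma splits_at_swap A : splits_at (swap_set A) -> splits_at A.
Proof.
move=> [y [e [g [[Ay Ae Ag] [[y1 y2] e12 g12]]]]].
exists (y.2, y.1), (g.2, g.1), (e.2, e.1); split=> //.
by split=> //; rewrite /nu /= y1 y2.
Qed.

Lemma diagonal_below_swap A : diagonal_below A -> diagonal_below (swap_set A).
Proof.
by move=> diag a Aa ne; have [|] := diag _ Aa; first exact: nesym.
Qed.

End Splitting.
End TwoBranches.

(** * The conductor of the Arf closure *)

Theorem lemma4p6 (K : fieldType) (n : nat) (phi psi : 'I_n -> fps K)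
    (M1 M2 : nat -> nat) (l D : nat) (c : nat * nat) :
  infinite_set [set: K] ->
  two_branch_curve phi psi ->
  is_multiplicity_sequence (branch_ring phi) M1 ->
  is_multiplicity_sequence (branch_ring psi) M2 ->
  (forall j, (0 < j)%N -> M1 j = M2 j) ->
  Dis phi psi !=set0 ->
  least [set d | exists2 i, Dis phi psi i &
                   mino (ord (phi i)) (ord (psi i)) = Some d] D ->
  is_length M1 l ->
  is_conductor (value_semigroup (arf_closure (curve_ring phi psi))) c ->
  (c.1 <= maxn (\sum_(1 <= j < l.+1) M1 j) D)%N /\ c.1 = c.2.
Proof.
move=> _ [pos _] mult1 mult2 M12 _ [[i0 i0Dis i0D] _] len [cbound cmin].
set R := curve_ring phi psi in cbound cmin *; set A := arf_closure R in cbound cmin *.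
have M1_1 j : (l < j)%N -> M1 j = 1%N.
  by case: len => [[M1_1 _] lj|[_ _ M1_1]]; [apply: M1_1; case: j lj|apply: M1_1].
have M2_1 j : (l < j)%N -> M2 j = 1%N.
  by move=> lj; rewrite -M12 ?M1_1 //; case: j lj.
have Aarf : arf_ring A by apply: arf_closure_arf => a; apply: curve_ring_const.
have Agen i : A (phi i, psi i) by apply: sub_arf_closure; apply: curve_ring_gen.
have valA d1 d2 : (c.1 <= d1)%N -> (c.2 <= d2)%N ->
    exists2 a, A a & nu a = (Some d1, Some d2).
  by move=> cd1 cd2; have := cbound (d1, d2) cd1 cd2.
(* Beyond the conductor all values occur, so [A] has elements of arbitrarily high finite value, as
   the lemma on projections requires. *)
have Abig N : exists2 b, A b & [/\ leqo N (ord b.1), leqo N (ord b.2),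
    b.1 != 0%R & b.2 != 0%R].
  have [b Ab [b1 b2]] := valA (c.1 + N) (c.2 + N) (leq_addr _ _) (leq_addr _ _).
  exists b => //; split; [| |exact: ord_neq0 b1|exact: ord_neq0 b2].
    by rewrite b1 /= leq_addl.
  by rewrite b2 /= leq_addl.
pose s m := \sum_(1 <= j < 1 + m) M1 j.
have s2 m : \sum_(1 <= j < 1 + m) M2 j = s m.
  by apply: eq_big_nat => j /andP[j0 _]; rewrite M12.
have [E1 [E2 [RE Earf E1s E2s]]] : exists E1 E2, [/\ R `<=` prod_set E1 E2,
    is_arf (prod_set E1 E2),
    forall f d, E1 f -> ord f = Some d -> exists m, d = s m
  & forall f d, E2 f -> ord f = Some d -> exists m, d = s m].
  have [T1 T11 bl1] := mult1; have [T2 T21 bl2] := mult2.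
  have [E1 [E1arf _ TE1 E1s]] :=
    @arf_branch_envelope _ _ _ _ bl1 M1_1 l 1 isT (add1n l).
  have [E2 [E2arf _ TE2 E2s]] :=
    @arf_branch_envelope _ _ _ _ bl2 M2_1 l 1 isT (add1n l).
  exists E1, E2; split=> //.
  - move=> x /curve_ring_branches[x1 x2].
    by split; [apply: TE1; rewrite T11|apply: TE2; rewrite T21].
  - by apply: arf_ring_is_arf; apply: prod_arf.
  - by move=> f d Ef fd; have [k ->] := E2s f d Ef fd; exists k; rewrite s2.
have AE x : A x -> prod_set E1 E2 x by apply.
have val1 a d : A a -> ord a.1 = Some d -> exists m, d = s m.
  by move=> /AE[Ea _]; apply: E1s.
have val2 a d : A a -> ord a.2 = Some d -> exists m, d = s m.
  by move=> /AE[_ Ea]; apply: E2s.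
have sval1 m : exists2 a, A a & ord a.1 = Some (s m).
  apply: (fst_values m Aarf _ _ mult1).
    by move=> N; have [b Ab [b1 _ _ b2]] := Abig N; exists b.
  by move=> i; exists (phi i, psi i).
have sval2 m : exists2 a, A a & ord a.2 = Some (s m).
  have [||a Aa am] := fst_values m (swap_arf Aarf) _ _ mult2.
  - move=> N; have [b Ab [_ b2 b1 _]] := Abig N; exists (b.2, b.1) => //.
    by rewrite /swap_set /= -surjective_pairing.
  - by move=> i; exists (psi i, phi i) => //; apply: Agen.
  - by exists (a.2, a.1) => //; rewrite /= am s2.
have s_large d : (s l <= d)%N -> exists m, d = s m.
  (* Past index [l] each further multiplicity adds exactly 1. *)
  move=> sd; exists (l + (d - s l))%N.
  have E : \sum_(l.+1 <= j < l.+1 + (d - s l)) M1 j = (d - s l)%N.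
    rewrite (eq_big_nat _ _ (F2 := fun=> 1%N)) => [|j /andP[lj _]].
      by rewrite sum_nat_const_nat muln1 addKn.
    exact: M1_1.
  rewrite {1}/s addnA add1n (@big_cat_nat _ _ _ l.+1) ?leq_addr //= E.
  by rewrite -[\sum_(1 <= i < l.+1) _]/(s l) subnKC.
(* The least such order is [t]; a generator whose two orders differ shows that [D] is a
   candidate. *)
pose P d := `[< exists2 a, A a & ord a.1 <> ord a.2 /\
                  mino (ord a.1) (ord a.2) = Some d >].
have PD : P D by apply/asboolP; exists (phi i0, psi i0).
have exP : exists d, P d by exists D.
case: (ex_minnP exP) => t /asboolP[e Ae [e12 et]] tmin.
have tD := tmin _ PD.
have diag : diagonal_below t A.
  move=> a Aa a12; have [d ad] : exists d, mino (ord a.1) (ord a.2) = Some d.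
    case: (ord a.1) (ord a.2) a12 => [d1|] [d2|] //= _.
    - by exists (minn d1 d2).
    - by exists d1.
    - by exists d2.
  have /tmin : P d by apply/asboolP; exists a.
  case: (ord a.1) (ord a.2) ad {a12} => [d1|] [d2|] //= [<-] //.
  by rewrite leq_min => /andP[].
have val_t : exists m, t = s m.
  case E1': (ord e.1) et => [d1|]; case E2': (ord e.2) => [d2|] //= -[<-].
  - by rewrite /minn; case: ifP => _; [exact: val1 E1'|exact: val2 E2'].
  - exact: val1 E1'.
  - exact: val2 E2'.
have split : splits_at t A.
  (* The element [e] has order [t] in exactly one component; the projections of [A] supply an
     element of order [t] in the other. *)
  have [m tm] := val_t; have [g1 Ag1 g1t] := sval1 m; have [g2 Ag2 g2t] := sval2 m.
  have [l1 l2] := diag e Ae e12; rewrite -tm in g1t g2t.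
  have [e1|ne1] := pselect (ord e.1 = Some t).
    apply: (splits_atP Aarf.1 diag Ae Ag2 e1 _ g2t).
    by apply: leqo_next => // e2; apply: e12; rewrite e1 e2.
  have e2 : ord e.2 = Some t.
    move: et (leqo_next l1 ne1) l2; case: (ord e.1) (ord e.2) => [d1|] [d2|] //=.
      rewrite /minn; case: ifP => _ [->] //; by rewrite ltnn.
    by move=> [->]; rewrite ltnn.
  apply: splits_at_swap.
  apply: (@splits_atP _ _ _ (e.2, e.1) (g1.2, g1.1) (swap_subalg Aarf.1)
    (diagonal_below_swap diag)) => //.
  - by rewrite /swap_set /= -surjective_pairing.
  - by rewrite /swap_set /= -surjective_pairing.
  - exact: leqo_next.
have tval d1 d2 : (t <= d1)%N -> (t <= d2)%N -> (exists m, d1 = s m) ->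
    (exists m, d2 = s m) -> exists2 a, A a & nu a = (Some d1, Some d2).
  move=> td1 td2 [m1 d1E] [m2 d2E].
  have [a1 Aa1 a1d] := sval1 m1; have [a2 Aa2 a2d] := sval2 m2.
  by apply: (split_values Aarf diag split td1 td2 Aa1 _ Aa2); rewrite ?d1E ?d2E.
have tc1 : (t <= c.1)%N.
  (* The value (c[1], c[1] + c[2] + 1) occurs and is off the diagonal, so both entries are at least
     [t]. *)
  have [a Aa [a1 a2]] := valA c.1 (c.1 + c.2).+1 (leqnn _) (leqW (leq_addl _ _)).
  have [|] := diag a Aa; rewrite a1 a2 // => -[/eqP].
  by rewrite ltn_eqF // ltnS leq_addr.
have tc2 : (t <= c.2)%N.
  have [a Aa [a1 a2]] := valA (c.1 + c.2).+1 c.2 (leqW (leq_addr _ _)) (leqnn _).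
  have [|] := diag a Aa; rewrite a1 a2 // => -[/eqP].
  by rewrite gtn_eqF // ltnS leq_addl.
have large1 d : (c.1 <= d)%N -> exists m, d = s m.
  by move=> cd; have [a Aa [ad _]] := valA d c.2 cd (leqnn _); exact: val1 ad.
have large2 d : (c.2 <= d)%N -> exists m, d = s m.
  by move=> cd; have [a Aa [_ ad]] := valA c.1 d (leqnn _) cd; exact: val2 ad.
split.
  have [] // : (c.1 <= maxn (s l) D)%N /\ (c.2 <= maxn (s l) D)%N.
  (* From this bound on, every integer is a partial sum and at least [t], so all pairs occur. *)
  apply: (cmin (maxn (s l) D, maxn (s l) D)) => -[a1 a2] /=.
  rewrite !geq_max => /andP[sa1 Da1] /andP[sa2 Da2].
  by apply: tval; [exact: leq_trans Da1|exact: leq_trans Da2|exact: s_large..].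
(* Both branches share the same partial sums, so (c[2], c[2]) and (c[1], c[1]) also satisfy
   [conductor_bound], and minimality gives the two inequalities. *)
apply/eqP; rewrite eqn_leq; apply/andP; split.
  have [] // : (c.1 <= c.2)%N /\ (c.2 <= c.2)%N.
  apply: (cmin (c.2, c.2)) => -[a1 a2] /= ca1 ca2.
  by apply: tval; [exact: leq_trans ca1|exact: leq_trans ca2|exact: large2..].
have [] // : (c.1 <= c.1)%N /\ (c.2 <= c.1)%N.
apply: (cmin (c.1, c.1)) => -[a1 a2] /= ca1 ca2.
by apply: tval; [exact: leq_trans ca1|exact: leq_trans ca2|exact: large1..].
Qed.
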